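(* Let $X$ be an $L_1$-predual space and let $F$ be a non-empty compact subset of $A_{\sigma}(B_{X^{\ast}})$. Then $\mathrm{cent}_{A_{\sigma}(B_{X^{\ast}})}(F)\neq\emptyset$ and $$\mathrm{cent}_{A_{\sigma}(B_{X^{\ast}})}(F)=\{a\in A_{\sigma}(B_{X^{\ast}}): M_{F}-r_{F}\le a\le m_{F}+r_{F}\text{ on }B_{X^{\ast}}\}.$$ Furthermore, $\mathrm{rad}_{A_{\sigma}(B_{X^{\ast}})}(F)=r_{F}$.
   Context: All Banach spaces are real. A Banach space $X$ is an $L_1$-predual space if its dual $X^{\ast}$ is isometric to $L_{1}(\mu)$ for some positive measure $\mu$. $B_{X^{\ast}}$ is the closed unit ball of $X^{\ast}$ endowed with the weak$^\ast$ topology. $A(B_{X^{\ast}})$ is the space of real-valued affine (weak$^\ast$-)continuous functions on $B_{X^{\ast}}$ with the supremum norm, $\sigma(x^{\ast})=-x^{\ast}$ for $x^{\ast}\in B_{X^{\ast}}$, and $A_{\sigma}(B_{X^{\ast}})=\{a\in A(B_{X^{\ast}}): a=-a\circ\sigma\}$, a closed subspace of $A(B_{X^{\ast}})$ (a Banach space; $X$ is isometrically isomorphic to it via $x\mapsto\overline{x}$, $\overline{x}(x^{\ast})=x^{\ast}(x)$). For a Banach space $Y$ and a non-empty closed bounded $B\subseteq Y$, put $r(y,B)=\sup\{\|y-b\|:b\in B\}$ for $y\in Y$, $\mathrm{rad}_{Y}(B)=\inf_{y\in Y}r(y,B)$, and $\mathrm{cent}_{Y}(B)=\{y\in Y:r(y,B)=\mathrm{rad}_{Y}(B)\}$.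 For a non-empty compact $F\subseteq A_{\sigma}(B_{X^{\ast}})$ and $x^{\ast}\in B_{X^{\ast}}$: $m_{F}(x^{\ast})=\inf\{b(x^{\ast}):b\in F\}$, $M_{F}(x^{\ast})=\sup\{b(x^{\ast}):b\in F\}$, and $r_{F}=\frac12\sup\{M_{F}(x^{\ast})-m_{F}(x^{\ast}):x^{\ast}\in B_{X^{\ast}}\}$. (For compact $F$ the functions $M_F,m_F$ are continuous.) *)

(* Defs.v *)
From HB Require Import structures.
From mathcomp Require Import all_boot all_order all_algebra.
From mathcomp Require Import all_classical all_reals all_analysis.
From mathcomp Require Import ring.

Set Implicit Arguments.
Unset Strict Implicit.
Unset Printing Implicit Defensive.
Import Order.TTheory GRing.Theory Num.Theory.
Import numFieldNormedType.Exports.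

Local Open Scope classical_set_scope.
Local Open Scope ring_scope.
Local Open Scope convex_scope.

(* In this file, [sup] and [inf] are real-valued, and are meaningful only for
   non-empty sets that are bounded on the relevant side: the definition of
   [radius_at] is intended for non-empty bounded [B], and those of [m_of]
   and [M_of] for non-empty compact [F]. *)

Section Centers.
Variables (R : realType) (Y : completeNormedModType R).

Definition radius_at (y : Y) (B : set Y) : R := sup [set `|y - b| | b in B].

Definition cheb_rad (B : set Y) : R := inf [set radius_at y B | y in [set: Y]].

Definition cheb_cent (B : set Y) : set Y :=
  [set y | radius_at y B = cheb_rad B].

End Centers.

Section Dual.
Variables (R : realType) (X : normedModType R).

Definition dual_pred : {pred X -> R^o} :=
  mem [set f : X -> R^o | linear f /\ continuous f].

Record dual_space := Dual { dual_fun :> X -> R^o ; _ : dual_fun \in dual_pred }.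

HB.instance Definition _ := [isSub for dual_fun].
HB.instance Definition _ := [Choice of dual_space by <:].

Lemma dual_submod_closed : submod_closed dual_pred.
Proof.
split.
  rewrite inE; split=> [k u v|]; last exact: cst_continuous.
  by rewrite /= scaler0 addr0.
move=> k f g; rewrite !inE => -[lf cf] [lg cg]; split=> [a u v|x] /=.
  rewrite -[LHS]/(k *: f (a *: u + v) + g (a *: u + v)).
  rewrite -[RHS]/(a *: (k *: f u + g u) + (k *: f v + g v)) lf lg.
  rewrite !scalerDr !scalerA [a * k]mulrC -!addrA; congr (_ + _).
  by rewrite addrCA.
by apply: cvgD; [apply: cvgZr; exact: cf|exact: cg].
Qed.

HB.instance Definition _ := GRing.isSubmodClosed.Build _ _ dual_pred
  dual_submod_closed.
HB.instance Definition _ := [SubChoice_isSubLmodule of dual_space by <:].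

Lemma dual_linear (f : dual_space) : linear f.
Proof. by case: f => f /= /set_mem []. Qed.

Lemma dual_continuous (f : dual_space) : continuous f.
Proof. by case: f => f /= /set_mem []. Qed.

Lemma dualP (f g : dual_space) : (forall x, f x = g x) -> f = g.
Proof. by move=> fg; apply: val_inj; apply/funext. Qed.

Definition dual_norm (f : dual_space) : R :=
  sup [set `|f x| | x in [set x | `|x| <= 1]].

Let pack_linear (f : X -> R^o) (lf : linear f) : {linear X -> R^o} :=
  HB.pack f (GRing.isLinear.Build _ _ _ _ _ lf).

Lemma dual_norm_has_sup (f : dual_space) :
  has_sup [set `|f x| | x in [set x | `|x| <= 1]].
Proof.
split; first by exists `|f 0|, 0 => //=; rewrite normr0.
have /(bounded_funP (pack_linear (dual_linear f))) /(_ 1)[M fM] :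
    bounded_near (pack_linear (dual_linear f)) (nbhs (0 : X)).
  by apply/linear_bounded_continuous; exact: dual_continuous.
by exists M => _ [x /= x1 <-]; exact: fM.
Qed.

Lemma dual_fun0 (f : dual_space) : f 0 = 0.
Proof. exact: (linear0 (pack_linear (dual_linear f))). Qed.

Lemma dual_funZ (f : dual_space) k x : f (k *: x) = k * f x.
Proof. exact: (linearZ_LR (pack_linear (dual_linear f)) k x). Qed.

Lemma dual_norm_ge (f : dual_space) x : `|x| <= 1 -> `|f x| <= dual_norm f.
Proof.
by move=> x1; apply: ub_le_sup; [case: (dual_norm_has_sup f)|exists x].
Qed.

Lemma dual_norm_le (f : dual_space) M :
  (forall x, `|x| <= 1 -> `|f x| <= M) -> dual_norm f <= M.
Proof.
move=> fM; apply: ge_sup; first by case: (dual_norm_has_sup f).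
by move=> _ [x x1 <-]; exact: fM.
Qed.

Lemma dual_norm_bound (f : dual_space) x : `|f x| <= dual_norm f * `|x|.
Proof.
have [->|x0] := eqVneq x 0; first by rewrite dual_fun0 !normr0 mulr0.
rewrite -ler_pdivrMr ?normr_gt0//.
have := @dual_norm_ge f (`|x|^-1 *: x).
rewrite dual_funZ !normrM normrZ !normfV !normr_id mulVf ?normr_eq0//.
by move=> /(_ (lexx _)); rewrite mulrC.
Qed.

Lemma ler_dual_normD (f g : dual_space) :
  dual_norm (f + g) <= dual_norm f + dual_norm g.
Proof.
apply: dual_norm_le => x x1; rewrite (le_trans (ler_normD _ _))//.
by rewrite lerD// dual_norm_ge.
Qed.

Lemma dual_normZ (k : R) (f : dual_space) :
  dual_norm (k *: f) = `|k| * dual_norm f.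
Proof.
have le_ k' f' : dual_norm (k' *: f') <= `|k'| * dual_norm f'.
  apply: dual_norm_le => x x1.
  rewrite -[X in `|X|]/(k' * f' x) normrM.
  by rewrite ler_wpM2l// dual_norm_ge.
have [->|k0] := eqVneq k 0.
  rewrite normr0 mul0r; apply/eqP; rewrite eq_le; apply/andP; split.
    by apply: dual_norm_le => x _; rewrite scale0r normr0.
  by rewrite (le_trans _ (@dual_norm_ge _ 0 _))// normr0.
apply/eqP; rewrite eq_le le_ /= -ler_pdivlMl ?normr_gt0//.
by rewrite -normfV -{1}[f](scalerK k0) le_.
Qed.

Lemma dual_norm0_eq0 (f : dual_space) : dual_norm f = 0 -> f = 0.
Proof.
move=> f0; apply: dualP => x; apply/eqP; rewrite -normr_le0.
by rewrite (le_trans (dual_norm_bound _ _))// f0 mul0r.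
Qed.

HB.instance Definition _ := Lmodule_isNormed.Build R dual_space
  ler_dual_normD dual_normZ dual_norm0_eq0.

End Dual.

(* [LspaceType1 mu], whose points are the a.e. classes of integrable functions,
   carries no vector space structure in the library: linearity of the
   surjective isometry [Phi] is expressed a.e. on the values. *)
Definition L1_predual (R : realType) (X : completeNormedModType R) : Prop :=
  exists (d : measure_display) (T : measurableType d)
    (mu : {measure set T -> \bar R}) (Phi : dual_space X -> LspaceType1 mu),
  [/\ bijective Phi,
      forall (k : R) (f g : dual_space X),
        ae_eq mu setT (Phi (k *: f + g)) (fun t => k * Phi f t + Phi g t) &
      forall f : dual_space X, 'N[mu]_1[EFin \o Phi f]%E = `|f|%:E].

Section DualBall.
Variables (R : realType) (X : normedModType R).

Record dual_ball :=
  DualBall { dual_ball_val :> dual_space X ; _ : `|dual_ball_val| <= 1 }.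

HB.instance Definition _ := [isSub for dual_ball_val].
HB.instance Definition _ := [Choice of dual_ball by <:].

(* The weak* topology, i.e. that of pointwise convergence on X. *)
HB.instance Definition _ := Topological.copy dual_ball
  (initial_topology (fun f : dual_ball => (f : X -> R^o) : {ptws X -> R^o})).

Lemma dual_ball0_subproof : `|0 : dual_space X| <= 1.
Proof. by rewrite normr0. Qed.
Definition dual_ball0 : dual_ball := DualBall dual_ball0_subproof.

Lemma dual_ball_opp_subproof (f : dual_ball) : `|- (f : dual_space X)| <= 1.
Proof. by rewrite normrN; case: f. Qed.
Definition dual_ball_opp (f : dual_ball) : dual_ball :=
  DualBall (dual_ball_opp_subproof f).

Lemma dual_ball_conv_subproof (t : {i01 R}) (f g : dual_ball) :
  `|((f : dual_space X) : convex_lmodType (dual_space X)) <| t |>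
    (g : dual_space X)| <= 1.
Proof.
case: f g => [f f1] [g g1] /=.
rewrite (le_trans (ler_normD _ _))// !normrZ.
rewrite [leRHS](_ : 1 = `|t%:num| * 1 + `|1 - t%:num| * 1).
  by rewrite lerD// ler_wpM2l.
by rewrite !mulr1 !ger0_norm ?subr_ge0 ?ge0 ?le1// addrC subrK.
Qed.
Definition dual_ball_conv (t : {i01 R}) (f g : dual_ball) : dual_ball :=
  DualBall (dual_ball_conv_subproof t f g).

Let conv1 f g : dual_ball_conv 1%:i01 f g = f.
Proof.
by apply: val_inj; exact: (@conv1 _ (convex_lmodType (dual_space X))).
Qed.
Let convmm t f : dual_ball_conv t f f = f.
Proof.
by apply: val_inj; exact: (@convmm _ (convex_lmodType (dual_space X))).
Qed.
Let convC t f g :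
  dual_ball_conv t f g = dual_ball_conv (1 - t%:inum)%:i01 g f.
Proof.
by apply: val_inj; exact: (@convC _ (convex_lmodType (dual_space X))).
Qed.
Let convA : convex_quasi_associative dual_ball_conv.
Proof.
move=> p q r s f g h pr sp; apply: val_inj.
exact: (@convA _ (convex_lmodType (dual_space X))).
Qed.

HB.instance Definition _ :=
  isConvexSpace.Build R dual_ball conv1 convmm convC convA.

End DualBall.

Section WeakStar.
Variables (R : realType) (X : normedModType R).
Implicit Types f g : dual_ball X.

Lemma cvg_dual_ball (F : set_system (dual_ball X)) (f : dual_ball X) :
  Filter F ->
  (forall x, (fun h : dual_ball X => h x : R) @ F --> (f x : R)) -> F --> f.
Proof.
move=> FF Ff A [_ [[B oB <-] Bf BA]].
apply: (filterS BA).
suff : {ptws, (fun h : dual_ball X => (h : X -> R^o)) @ F --> (f : X -> R^o)}.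
  by apply; exact: open_nbhs_nbhs.
apply/cvg_sup => x.
apply/cvg_image; first by rewrite eqEsubset; split=> y // _; exists (cst y).
move=> U /= Uf; have := Ff x U Uf => FU.
exists [set h : X -> R^o | U (h x)] => //.
by rewrite eqEsubset; split=> [y [h Uh <-//]|y Uy]; exists (cst y).
Qed.

Lemma dual_ball_eval_continuous (x : X) :
  continuous (fun f : dual_ball X => f x : R).
Proof.
move=> f; apply: (@continuous_comp (dual_ball X) {ptws X -> R^o} R
  (fun f => (f : X -> R^o)) (fun h => h x)).
  exact: (@initial_continuous _ {ptws X -> R^o}
    (fun f : dual_ball X => (f : X -> R^o))).
exact: (@proj_continuous _ (fun=> R^o)).
Qed.

Lemma dual_ball_bound f x : `|f x| <= `|x|.
Proof.
rewrite (le_trans (dual_norm_bound _ _))// ler_piMl//.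
by case: f.
Qed.

Lemma dual_ball_compact : compact [set: dual_ball X].
Proof.
rewrite compact_ultra => F UF _.
have cF x : exists l : R, (fun h : dual_ball X => h x : R) @ F --> l.
  have [|l [_ clF]] := @segment_compact R (- `|x|) `|x|
      ((fun h : dual_ball X => h x : R) @ F) _.
    rewrite /fmap /=; apply: (@filterS _ F _ setT); last exact: filterT.
    by move=> h _ /=; rewrite in_itv/= -ler_norml; exact: dual_ball_bound.
  exists l => U Ul.
  have [//|FU] :=
    in_ultra_setVsetC ((fun h : dual_ball X => h x : R) @^-1` U) UF.
  by have [y [+ Uy]] := clF (~` U) U FU Ul; case.
have [l Fl] := choice cF.
have ll : linear (l : X -> R^o).
  move=> k u v.
  apply: (@cvg_unique _ (@norm_hausdorff _ _) 
    ((fun h : dual_ball X => h (k *: u + v) : R) @ F)) => /=; first exact: Fl.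
  rewrite (_ : (fun _ => _) = (fun h : dual_ball X => k * h u + h v : R)).
    by apply: cvgD => //; apply: cvgM => //; exact: cvg_cst.
  by apply/funext => h; exact: dual_linear.
have l1 x : `|l x| <= `|x|.
  rewrite -(cvg_lim (@norm_hausdorff _ _) (cvg_norm (Fl x))).
  apply: limr_le; first by apply/cvg_ex; eexists; exact: cvg_norm (Fl x).
  by apply: nearW => h; exact: dual_ball_bound.
have lc : continuous (l : X -> R^o).
  pose L : {linear X -> R^o} := HB.pack l (GRing.isLinear.Build _ _ _ _ _ ll).
  apply/(linear_bounded_continuous L)/bounded_funP => r; exists r => x.
  exact: le_trans.
have lP : (l : X -> R^o) \in @dual_pred R X by rewrite inE.
have lb : `|Dual lP| <= 1.
  by apply: dual_norm_le => x x1; rewrite (le_trans (l1 x)).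
by exists (DualBall lb); split => //; exact: cvg_dual_ball.
Qed.

End WeakStar.

Section AffineFunctions.
Variables (R : realType) (X : normedModType R).

(* A(B_{X*}); continuity is for the weak* topology of [dual_ball]. *)
Definition affine_continuous (a : dual_ball X -> R^o) : Prop :=
  (forall (t : {i01 R}) f g, a (f <| t |> g) = a f <| t |> a g) /\
  continuous a.

Definition Asigma_pred : {pred dual_ball X -> R^o} :=
  mem [set a | affine_continuous a /\ a = \- (a \o @dual_ball_opp R X)].

Record Asigma :=
  MkAsigma { Asigma_fun :> dual_ball X -> R^o ;
             _ : Asigma_fun \in Asigma_pred }.

HB.instance Definition _ := [isSub for Asigma_fun].
HB.instance Definition _ := [Choice of Asigma by <:].

Lemma Asigma_submod_closed : submod_closed Asigma_pred.
Proof.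
split.
  rewrite inE; split; last by apply/funext => f /=; rewrite oppr0.
  split; last exact: cst_continuous.
  by move=> t f g; rewrite convRE !mulr0 addr0.
move=> k a b; rewrite !inE => -[[aff_a ca] oa] [[aff_b cb] ob].
split; [split=> [t f g|f]|].
- rewrite -[LHS]/(k *: a (f <| t |> g) + b (f <| t |> g)).
  rewrite -[RHS]/((k *: a f + b f : R^o) <| t |> (k *: a g + b g : R^o)).
  rewrite aff_a aff_b !convRE /GRing.scale/= !mulrDr !mulrA.
  by rewrite [k * _]mulrC [k * _]mulrC addrACA.
- have ckab : (fun g => k * a g + b g : R) @ nbhs f --> (k * a f + b f : R).
    by apply: cvgD; [apply: cvgM; [exact: cvg_cst|exact: ca]|exact: cb].
  exact: ckab.
- apply/funext => f /=.
  rewrite -[LHS]/(k *: a f + b f).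
  rewrite -[RHS]/(- (k *: a (dual_ball_opp f) + b (dual_ball_opp f))).
  by rewrite opprD -scalerN {1}oa {1}ob.
Qed.

HB.instance Definition _ := GRing.isSubmodClosed.Build _ _ Asigma_pred
  Asigma_submod_closed.
HB.instance Definition _ := [SubChoice_isSubLmodule of Asigma by <:].

Lemma Asigma_affine_continuous (a : Asigma) : affine_continuous a.
Proof. by case: a => a /= /set_mem []. Qed.

Lemma Asigma_odd (a : Asigma) f : a f = - a (dual_ball_opp f).
Proof. by case: a => a /= /set_mem [_ {1}->]. Qed.

Lemma AsigmaP (a b : Asigma) : (forall f, a f = b f) -> a = b.
Proof. by move=> ab; apply: val_inj; apply/funext. Qed.

Definition Asigma_norm (a : Asigma) : R :=
  sup [set `|a f| | f in [set: dual_ball X]].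

Lemma Asigma_norm_has_sup (a : Asigma) :
  has_sup [set `|a f| | f in [set: dual_ball X]].
Proof.
apply: compact_has_sup; first by exists `|a (dual_ball0 X)|, (dual_ball0 X).
have ca : {within [set: dual_ball X], continuous (fun f => `|a f|)}.
  apply: continuous_subspaceT => f.
  exact: cvg_norm ((Asigma_affine_continuous a).2 f).
exact: continuous_compact ca (@dual_ball_compact R X).
Qed.

Lemma Asigma_norm_ge (a : Asigma) f : `|a f| <= Asigma_norm a.
Proof.
by apply: ub_le_sup; [case: (Asigma_norm_has_sup a)|exists f].
Qed.

Lemma Asigma_norm_le (a : Asigma) M :
  (forall f, `|a f| <= M) -> Asigma_norm a <= M.
Proof.
move=> aM; apply: ge_sup; first by case: (Asigma_norm_has_sup a).
by move=> _ [f _ <-]; exact: aM.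
Qed.

Lemma ler_Asigma_normD (a b : Asigma) :
  Asigma_norm (a + b) <= Asigma_norm a + Asigma_norm b.
Proof.
apply: Asigma_norm_le => f; rewrite (le_trans (ler_normD _ _))//.
by rewrite lerD// Asigma_norm_ge.
Qed.

Lemma Asigma_normZ (k : R) (a : Asigma) :
  Asigma_norm (k *: a) = `|k| * Asigma_norm a.
Proof.
have le_ k' a' : Asigma_norm (k' *: a') <= `|k'| * Asigma_norm a'.
  apply: Asigma_norm_le => f.
  rewrite -[X in `|X|]/(k' * a' f) normrM.
  by rewrite ler_wpM2l// Asigma_norm_ge.
have [->|k0] := eqVneq k 0.
  rewrite normr0 mul0r; apply/eqP; rewrite eq_le; apply/andP; split.
    by apply: Asigma_norm_le => f; rewrite scale0r normr0.
  by rewrite (le_trans _ (Asigma_norm_ge _ (dual_ball0 X)))// normr_ge0.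
apply/eqP; rewrite eq_le le_ /= -ler_pdivlMl ?normr_gt0//.
by rewrite -normfV -{1}[a](scalerK k0) le_.
Qed.

Lemma Asigma_norm0_eq0 (a : Asigma) : Asigma_norm a = 0 -> a = 0.
Proof.
move=> a0; apply: AsigmaP => f; apply/eqP; rewrite -normr_le0.
by rewrite (le_trans (Asigma_norm_ge _ _))// a0.
Qed.

HB.instance Definition _ := Lmodule_isNormed.Build R Asigma
  ler_Asigma_normD Asigma_normZ Asigma_norm0_eq0.

Lemma Asigma_complete (F : set_system Asigma) :
  ProperFilter F -> cauchy F -> cvg F.
Proof.
move=> FF Fc.
have close (e : R) : 0 < e -> exists2 a0 : Asigma,
    F [set a : Asigma | `|a0 - a| < e] &
    F [set a : Asigma | forall f, `|a0 f - a f| <= e].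
  move=> e0; have /cauchyP/(_ e e0)[a0] := Fc; rewrite -ball_normE => Fa0.
  exists a0 => //; apply: filterS Fa0 => a /= a0a f.
  exact: le_trans (Asigma_norm_ge (a0 - a) f) (ltW a0a).
have cF f : exists l : R, (fun a : Asigma => a f : R) @ F --> l.
  apply/cvg_ex; apply: (R_complete (F := (fun a : Asigma => a f : R) @ F)).
  apply/cauchyP => e e0.
  have [a0 _ Fa0] := close (e / 2) (divr_gt0 e0 (ltr0n _ 2)).
  exists (a0 f); rewrite -ball_normE /fmap /=.
  apply: (@filterS _ F _ _ _ _ Fa0) => a /= /(_ f).
  by move=> /le_lt_trans; apply; rewrite ltr_pdivrMr// ltr_pMr// ltr1n.
have [l Fl] := choice cF.
have lclose (e : R) : 0 < e -> exists a0 : Asigma,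
    F [set a : Asigma | `|a0 - a| < e] /\ forall f, `|a0 f - l f| <= e.
  move=> e0; have [a0 Fa0 Fe] := close e e0; exists a0; split=> // f.
  have Fn : (fun a : Asigma => `|a0 f - (a f : R)|) @ F --> `|a0 f - l f|.
    by apply: cvg_norm; apply: cvgB => //; exact: cvg_cst.
  rewrite -(cvg_lim (@norm_hausdorff _ _) Fn).
  apply: limr_le; first by apply/cvg_ex; eexists; exact: Fn.
  by apply: (@filterS _ F _ _ _ _ Fe) => a /(_ f).
have lP : (l : dual_ball X -> R^o) \in Asigma_pred.
  rewrite inE; split; [split=> [t f g|f]|].
  - apply: (@cvg_unique _ (@norm_hausdorff _ _)
      ((fun a : Asigma => a (f <| t |> g) : R) @ F)) => /=; first exact: Fl.
    rewrite (_ : (fun _ => _) =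
      (fun a : Asigma => t%:num * a f + (1 - t%:num) * a g : R)).
      by apply: cvgD; apply: cvgM => //; exact: cvg_cst.
    by apply/funext => a; exact: (Asigma_affine_continuous a).1.
  - apply/(@cvgrPdist_le _ _ _ (nbhs (f : dual_ball X))) => e e0.
    have e30 : 0 < e / 3 by rewrite divr_gt0.
    have [a0 [_ a0l]] := lclose (e / 3) e30.
    have /(@cvgrPdist_le _ _ _ (nbhs (f : dual_ball X)))/(_ _ e30) :=
      (Asigma_affine_continuous a0).2 f.
    apply: filterS => g /= a0fg.
    rewrite (_ : l f - l g =
      (a0 f - a0 g) - (a0 f - l f) + (a0 g - l g)); last by ring.
    rewrite (le_trans (ler_normD _ _))// (_ : e = e / 3 + e / 3 + e / 3).
      by rewrite lerD// (le_trans (ler_normB _ _))// lerD.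
    by field.
  - apply/funext => f.
    apply: (@cvg_unique _ (@norm_hausdorff _ _)
      ((fun a : Asigma => a f : R) @ F)) => /=; first exact: Fl.
    rewrite (_ : (fun _ => _) = (fun a : Asigma => - a (dual_ball_opp f) : R)).
      exact: cvgN.
    by apply/funext => a; exact: Asigma_odd.
apply/cvg_ex; exists (MkAsigma lP); apply/cvgrPdist_le => e e0.
have e20 : 0 < e / 2 by rewrite divr_gt0.
have [a0 [Fa0 a0l]] := lclose (e / 2) e20.
apply: filterS Fa0 => a a0a.
rewrite -(subrKA a0) (le_trans (ler_normD _ _))// (splitr e) lerD//.
  by rewrite distrC; apply: Asigma_norm_le => f; exact: a0l.
exact: ltW.
Qed.

HB.instance Definition _ := Uniform_isComplete.Build Asigma Asigma_complete.


End AffineFunctions.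

Section Envelopes.
Variables (R : realType) (X : normedModType R).
Implicit Type F : set (Asigma X).

Definition m_of F (f : dual_ball X) : R := inf [set (b : Asigma X) f | b in F].

Definition M_of F (f : dual_ball X) : R := sup [set (b : Asigma X) f | b in F].

Definition r_of F : R :=
  2^-1 * sup [set M_of F f - m_of F f | f in [set: dual_ball X]].

End Envelopes.

(* Main.v *)
Require Import Defs.
From HB Require Import structures.
From mathcomp Require Import all_boot all_order all_algebra.
From mathcomp Require Import all_classical all_reals all_analysis.
From mathcomp Require Import measurable_realfun ring lra.
Set Implicit Arguments.
Unset Strict Implicit.
Unset Printing Implicit Defensive.
Import Order.TTheory GRing.Theory Num.Theory.
Import numFieldNormedType.Exports.
Local Open Scope classical_set_scope.
Local Open Scope ring_scope.

(* The center [a] is a common point of the balls [B(b, r_F)], b in [F], which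
   meet pairwise since [2 r_F] is the diameter of [F].

   For finitely many balls [B(x_i, r_i)] in [X] with [|x_i - x_j| <= r_i + r_j],
   the Hahn-Banach theorem in [X ^ n] reduces the existence of a common point,
   up to [e], to the inequality [sum_i f_i(x_i) <= sum_i r_i |f_i|] for
   functionals [f_i] of sum 0.  In [L_1], one can write [f_i = sum_j g_ij] with
   [g_ji = - g_ij] and [|f_i| = sum_j |g_ij|]; then [sum_i f_i(x_i)] is half the
   sum of the [g_ij(x_i - x_j)], which is at most half the sum of the
   [|g_ij| (r_i + r_j)], that is [sum_i r_i |f_i|].

   Evaluations at points of [X] are dense in [A_sigma]: by weak* continuity
   at 0, [a] is small on the part of the ball where some [x_1, ..., x_n] vanish,
   so by the Hahn-Banach theorem it is uniformly close to a combination of the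
   [x_i].

   For compact [F], if [|a_n - b| <= r_F + e_n] on [F], then the balls
   [B(b, r_F)], b in a finite net, and [B(a_n, e_n)] almost meet: this gives
   [a_(n+1)] with [e_(n+1) = e_n / 2] and [|a_(n+1) - a_n| <= 2 e_n], and [a_n]
   converges. *)

(** * The Hahn-Banach theorem *)

Section HahnBanach.
Variables (R : realType) (V : lmodType R).
Implicit Types (p q : V -> R) (x y : V).

(* Applied to [t^-1], the inequality on multiples becomes an equality. *)
Definition sublinear p : Prop :=
  (forall x y, p (x + y) <= p x + p y) /\
  (forall t x, 0 < t -> p (t *: x) <= t * p x).

Lemma sublinearZ p t x : sublinear p -> 0 < t -> p (t *: x) = t * p x.
Proof.
move=> [_ pZ] t0; apply/eqP; rewrite eq_le pZ//= -ler_pdivlMl//.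
by rewrite (le_trans _ (pZ _ _ _)) ?invr_gt0// scalerK ?gt_eqF.
Qed.

Lemma sublinear0 p : sublinear p -> p 0 = 0.
Proof.
move=> sp; have := sublinearZ 0 sp (ltr0n R 2).
by rewrite scaler0 => p0; lra.
Qed.

Lemma sublinear_ge p x : sublinear p -> - p (- x) <= p x.
Proof.
move=> sp; have := sp.1 x (- x); rewrite subrr (sublinear0 sp).
by rewrite addrC -lerBlDl sub0r.
Qed.

(* The largest sublinear function below [q] with value at most [- q y] at [- y]:
   a minimal sublinear function is equal to all its tilts, hence odd. *)
Definition tilt q y x : R :=
  inf [set q (x + t *: y) - t * q y | t in `[0, +oo[].

Lemma tilt_has_inf q y x : sublinear q ->
  has_inf [set q (x + t *: y) - t * q y | t in `[0, +oo[].
Proof.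
move=> sq; split.
  by exists (q (x + 0 *: y) - 0 * q y), 0 => //=; rewrite in_itv/= lexx.
exists (- q (- x)) => _ [t /= + <-].
rewrite in_itv/= andbT le_eqVlt => /predU1P[<-|t0].
  by rewrite scale0r mul0r addr0 subr0 sublinear_ge.
(* Subadditivity bounds [t * q y = q (t *: y)] by [q (x + t *: y) + q (- x)]. *)
rewrite lerBrDl -(sublinearZ y sq t0) lerBlDr.
by rewrite (le_trans _ (sq.1 _ _))// addrAC subrr add0r.
Qed.

Lemma tilt_le q y x t : sublinear q -> 0 <= t ->
  tilt q y x <= q (x + t *: y) - t * q y.
Proof.
move=> sq t0; apply: ge_inf; first by case: (tilt_has_inf y x sq).
by exists t => //=; rewrite in_itv/= t0.
Qed.

Lemma tilt_ge q y x m : sublinear q ->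
  (forall t, 0 <= t -> m <= q (x + t *: y) - t * q y) -> m <= tilt q y x.
Proof.
move=> sq mq; apply: lb_le_inf; first by case: (tilt_has_inf y x sq).
by move=> _ [t /= + <-]; rewrite in_itv/= andbT => /mq.
Qed.

(** Parameters [t] for [x] and [u] for [z] give the parameter [t + u] for [x + z]. *)
Lemma sublinear_tilt q y : sublinear q -> sublinear (tilt q y).
Proof.
move=> sq; split=> [x z|s x s0].
  rewrite -lerBlDr; apply: tilt_ge => // t t0.
  rewrite lerBlDr -lerBlDl; apply: tilt_ge => // u u0.
  rewrite lerBlDl (le_trans (tilt_le y _ sq (addr_ge0 t0 u0)))//.
  rewrite scalerDl addrACA mulrDl.
  by have := sq.1 (x + t *: y) (z + u *: y); lra.
rewrite -ler_pdivrMl//; apply: tilt_ge => // t t0; rewrite ler_pdivrMl//.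
rewrite (le_trans (tilt_le y _ sq (mulr_ge0 (ltW s0) t0)))//.
by rewrite -scalerA -scalerDr sublinearZ// mulrBr mulrA.
Qed.

Lemma tilt_le_id q y x : sublinear q -> tilt q y x <= q x.
Proof.
move=> sq; rewrite (le_trans (tilt_le y x sq (lexx 0)))//.
by rewrite scale0r mul0r addr0 subr0.
Qed.

Lemma tilt_opp q y : sublinear q -> tilt q y (- y) <= - q y.
Proof.
move=> sq; rewrite (le_trans (tilt_le y _ sq ler01))//.
by rewrite scale1r addNr (sublinear0 sq) mul1r sub0r.
Qed.

Let below p := {q : V -> R | sublinear q /\ forall x, q x <= p x}.
(** The order is reversed: the maximal elements of Zorn's lemma are minimal sublinear functions. *)
Let order p : rel (below p) :=
  fun b c => `[< forall x, sval c x <= sval b x >].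

Lemma minimal_sublinear p : sublinear p -> exists q,
  [/\ sublinear q, forall x, q x <= p x &
      forall q', sublinear q' -> (forall x, q' x <= q x) -> q' = q].
Proof.
move=> sp; have [||||[q [sq qp]] qmin] := @Zorn (below p) (@order p).
- by move=> q; apply/asboolP.
- move=> q r s /asboolP qr /asboolP rs; apply/asboolP => x.
  exact: le_trans (qr x).
- move=> [q qP] [r rP] /asboolP/= qr /asboolP/= rq; apply: eq_exist.
  by apply/funext => x; apply/eqP; rewrite eq_le rq qr.
- move=> A totA; have [->|/set0P[q0 Aq0]] := eqVneq A set0.
    by exists (exist _ p (conj sp (fun=> lexx _))).
  pose S x := [set sval q x | q in A].
  have S_inf x : has_inf (S x).
    split; first by exists (sval q0 x), q0.
    exists (- p (- x)) => _ [[q [sq qp]] Aq <-] /=.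
    by rewrite (le_trans _ (sublinear_ge _ sq))// lerN2.
  pose m x := inf (S x).
  have m_le (q : below p) x : A q -> m x <= sval q x.
    by move=> Aq; apply: ge_inf; [case: (S_inf x)|exists q].
  have m_ge x c : (forall q : below p, A q -> c <= sval q x) -> c <= m x.
    move=> cq; apply: lb_le_inf; first by case: (S_inf x).
    by move=> _ [q Aq <-]; exact: cq.
  have sm : sublinear m.
    split=> [x y|t x t0].
      rewrite -lerBlDr; apply: (m_ge) => q Aq.
      rewrite lerBlDr -lerBlDl; apply: (m_ge) => r Ar; rewrite lerBlDl.
      (* Of two members of the chain, the smaller serves both for [x] and for [y]. *)
      have [/asboolP qr|/asboolP rq] := totA _ _ Aq Ar.
        rewrite (le_trans (m_le _ _ Ar))// (le_trans ((svalP r).1.1 _ _))//.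
        by rewrite lerD.
      rewrite (le_trans (m_le _ _ Aq))// (le_trans ((svalP q).1.1 _ _))//.
      by rewrite lerD.
    rewrite -ler_pdivrMl//; apply: (m_ge) => q Aq; rewrite ler_pdivrMl//.
    by rewrite (le_trans (m_le _ _ Aq))// (svalP q).1.2.
  have mp x : m x <= p x by rewrite (le_trans (m_le _ x Aq0))// (svalP q0).2.
  exists (exist _ m (conj sm mp)) => q Aq; apply/asboolP => x; exact: m_le.
- exists q; split=> // r sr rq.
  have rp x : r x <= p x by exact: le_trans (qp x).
  have := qmin (exist _ r (conj sr rp)).
  by move=> /(_ (asboolT rq)) [].
Qed.

(** A minimal sublinear function is odd, hence linear. Starting from [tilt p x0] instead of [p]
    forces [l (- x0) <= - p x0], whence equality at [x0]. *)
Lemma hahn_banach_sublinear p x0 : sublinear p -> exists l : V -> R^o,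
  [/\ linear l, forall x, l x <= p x & l x0 = p x0].
Proof.
move=> sp; have [l [sl lp lmin]] := minimal_sublinear (sublinear_tilt x0 sp).
have lN y : l (- y) = - l y.
  apply/eqP; rewrite eq_le; apply/andP; split; last first.
    by rewrite lerNl sublinear_ge.
  rewrite -{1}(lmin _ (sublinear_tilt y sl)) ?tilt_opp// => x.
  exact: tilt_le_id.
have lD x y : l (x + y) = l x + l y.
  apply/eqP; rewrite eq_le sl.1/=.
  by have := sl.1 (- x) (- y); rewrite -opprD !lN; lra.
exists l; split=> [k x y|x|].
- rewrite lD; congr (_ + _); have [k0|k0|->] := ltgtP k 0.
  + rewrite -[k]opprK scaleNr lN (@sublinearZ _ (- k)) ?oppr_gt0//.
    by rewrite mulNr !opprK.
  + exact: sublinearZ.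
  + by rewrite !scale0r sublinear0.
- exact: le_trans (tilt_le_id _ _ sp).
- apply/eqP; rewrite eq_le (le_trans (lp x0) (tilt_le_id _ _ sp))/=.
  by rewrite -lerN2 -lN (le_trans (lp _))// tilt_opp.
Qed.

End HahnBanach.

(** * Antisymmetric decomposition in the dual of an L1-predual *)

(* The numerator vanishes unless [c i] and [c j] have opposite signs. *)
Definition transport (R : realFieldType) n (c : 'I_n -> R) (i j : 'I_n) : R :=
  (c i * `|c j| - `|c i| * c j) / \sum_k `|c k|.

Section Transport.
Variables (R : realFieldType) (n : nat).
Implicit Type c : 'I_n -> R.

Lemma transportC c i j : transport c j i = - transport c i j.
Proof. by rewrite /transport -[RHS]mulNr; congr (_ / _); ring. Qed.

Lemma sum_norm_eq0 c i : \sum_k `|c k| = 0 -> c i = 0.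
Proof.
move=> /eqP; rewrite psumr_eq0// => /allP/(_ i).
by rewrite mem_index_enum normr_eq0 => /(_ isT)/eqP.
Qed.

Lemma sum_transport c i : \sum_j c j = 0 -> \sum_j transport c i j = c i.
Proof.
move=> c0; rewrite -mulr_suml sumrB -!mulr_sumr c0 mulr0 subr0.
have [S0|S0] := eqVneq (\sum_k `|c k|) 0; last by rewrite mulfK.
by rewrite (sum_norm_eq0 i S0) !mul0r.
Qed.

(** Whatever the signs, the numerator has absolute value [|c i| * |c j| - c i * c j], whose second
    term sums to 0 over [j]. *)
Lemma sum_norm_transport c i : \sum_j c j = 0 ->
  \sum_j `|transport c i j| = `|c i|.
Proof.
move=> c0; have S_ge0 : 0 <= \sum_k `|c k| by exact: sumr_ge0.
have -> : \sum_j `|transport c i j| =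
    (\sum_j (`|c i| * `|c j| - c i * c j)) / \sum_k `|c k|.
  rewrite mulr_suml; apply: eq_bigr => j _.
  rewrite /transport normrM normfV (ger0_norm S_ge0). congr (_ * _).
  have [ci|ci] := lerP 0 (c i).
    by rewrite (ger0_norm ci) ger0_norm// -mulrBr mulr_ge0// subr_ge0 ler_norm.
  rewrite (ltr0_norm ci) mulNr opprK ler0_norm; first by ring.
  rewrite -mulrDr mulr_le0_ge0 ?(ltW ci)//.
  by rewrite -lerBlDr sub0r -normrN ler_norm.
rewrite sumrB -!mulr_sumr c0 mulr0 subr0.
have [S0|S0] := eqVneq (\sum_k `|c k|) 0; last by rewrite mulfK.
by rewrite (sum_norm_eq0 i S0) normr0 !mul0r.
Qed.

End Transport.

Section L1Predual.
Variables (R : realType) (X : completeNormedModType R).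
Variables (d : measure_display) (T : measurableType d).
Variable mu : {measure set T -> \bar R}.

Let measurable_abse_EFin (g : T -> R) : measurable_fun setT g ->
  measurable_fun setT (fun t => `|(EFin \o g) t|%E).
Proof.
move=> mg; apply: (measurableT_comp (@abse_measurable R setT)).
exact/measurable_EFinP.
Qed.

Lemma Lnorm1_ae_eq (g h : T -> R) :
  measurable_fun setT g -> measurable_fun setT h -> ae_eq mu setT g h ->
  'N[mu]_1[EFin \o g]%E = 'N[mu]_1[EFin \o h]%E.
Proof.
move=> mg mh gh; rewrite !Lnorm1; apply: ge0_ae_eq_integral => //.
- exact: measurable_abse_EFin.
- exact: measurable_abse_EFin.
- by apply: filterS gh => t /[apply] /= ->.
Qed.

(** The canonical representative of the class of [g] is only a.e. equal to [g], which still gives it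
    a finite norm. *)
Lemma LspaceType1_lift (g : T -> R) : measurable_fun setT g ->
  ('N[mu]_1[EFin \o g] < +oo)%E ->
  exists G : LspaceType1 mu, ae_eq mu setT G g.
Proof.
move=> mg g_fin.
pose m : {mfun T >-> measurableTypeR R} := 
    HB.pack (g : T -> measurableTypeR R)
      (@isMeasurableFun.Build _ _ T (measurableTypeR R) g mg).
pose c : {mfun_ mu, T >-> measurableTypeR R} := (\pi m)%qT.
have cg : ae_eq mu setT c g.
  by have /eqmodP/asboolP cm := reprK c; exact: cm.
have c_fin : finite_norm mu 1 c.
  rewrite /finite_norm (Lnorm1_ae_eq _ mg cg)//.
  exact: (@measurable_funPT _ _ _ _ (repr c)).
pose G : LspaceType1 mu := 
  HB.pack c (isFinLebesgue.Build _ _ _ mu _ (lexx 1%E) c c_fin).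
by exists G.
Qed.

Variable Phi : dual_space X -> LspaceType1 mu.
Hypothesis Phi_bij : bijective Phi.
Hypothesis Phi_linear : forall (k : R) (f g : dual_space X),
  ae_eq mu setT (Phi (k *: f + g)) (fun t => k * Phi f t + Phi g t).
Hypothesis Phi_norm : forall f : dual_space X,
  'N[mu]_1[EFin \o Phi f]%E = `|f|%:E.

Let mPhi f : measurable_fun setT (Phi f : T -> R).
Proof.
pose c : {mfun_ mu, T >-> measurableTypeR R} := Phi f.
exact: (@measurable_funPT _ _ _ _ (repr c)).
Qed.

Let Phi0 : ae_eq mu setT (Phi 0) (cst 0).
Proof.
have := Phi_linear (-1) 0 0; rewrite scaler0 addr0.
by apply: filterS => t /(_ I) -> _; rewrite mulN1r addNr.
Qed.

Let Phi_sum n (f : 'I_n -> dual_space X) :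
  ae_eq mu setT (Phi (\sum_i f i)) (fun t => \sum_i Phi (f i) t).
Proof.
elim: n f => [|n IH] f.
  by apply: filterS Phi0 => t; rewrite !big_ord0.
rewrite big_ord_recl -[f ord0]scale1r.
have := Phi_linear 1 (f ord0) (\sum_i f (lift ord0 i)).
have := IH (fun i => f (lift ord0 i)).
apply: filterS2 => t /(_ I) ft /(_ I) -> _.
by rewrite big_ord_recl mul1r ft.
Qed.

(** The isometry turns a.e. equality of the values into [|f - g| = 0]. *)
Let Phi_inj f g : ae_eq mu setT (Phi f) (Phi g) -> f = g.
Proof.
move=> fg; apply/eqP; rewrite -subr_eq0 -normr_eq0 -eqe -Phi_norm.
rewrite (@Lnorm1_ae_eq _ (cst 0)) ?Lnorm0//.
have := Phi_linear (-1) g f; rewrite scaleN1r addrC.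
by apply: filterS2 fg => t /(_ I) -> /(_ I) -> _; rewrite mulN1r addNr.
Qed.

(** [transport] is applied at each point [t] to the values [Phi (f k) t], whose sum vanishes a.e.;
    the surjectivity of [Phi] brings the resulting integrable functions back to the dual. *)
Lemma dual_transport n (f : 'I_n -> dual_space X) : \sum_i f i = 0 ->
  exists g : 'I_n -> 'I_n -> dual_space X,
  [/\ forall i j, g j i = - g i j, forall i, \sum_j g i j = f i &
      forall i, \sum_j `|g i j| = `|f i|].
Proof.
move=> f0; pose h i j (t : T) : R := transport (fun k => Phi (f k) t) i j.
have Sf0 : ae_eq mu setT (fun t => \sum_i Phi (f i) t) (cst 0).
  have := Phi_sum f; rewrite f0.
  by apply: filterS2 Phi0 => t /(_ I) -> /(_ I) ->.
have mh i j : measurable_fun setT (h i j).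
  rewrite /h /transport; apply: measurable_funM.
    apply: measurable_funB; apply: measurable_funM => //;
      exact: measurableT_comp.
  (* The inverse is a power of exponent -1, the base being nonnegative; powers are measurable. *)
  rewrite (_ : (fun _ => _) = (fun t => (\sum_k `|Phi (f k) t|) `^ (-1))).
    apply: (measurableT_comp (measurable_powR _)).
    by apply: measurable_sum => k; exact: measurableT_comp.
  by apply/funext => t; rewrite powR_inv1// sumr_ge0.
have h_norm i : (\sum_j 'N[mu]_1[EFin \o h i j] = `|f i|%:E)%E.
  rewrite -Phi_norm; under eq_bigr do rewrite Lnorm1.
  rewrite Lnorm1 -ge0_integral_sum//; last first.
    by move=> j; exact: measurable_abse_EFin.
  apply: ge0_ae_eq_integral => //.
  - by apply: emeasurable_sum => j; exact: measurable_abse_EFin.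
  - by exact: measurable_abse_EFin.
  - by move=> t _; apply: sume_ge0.
  - apply: filterS Sf0 => t /(_ I) /= S0 _.
    by rewrite sumEFin sum_norm_transport.
have h_fin i j : ('N[mu]_1[EFin \o h i j] < +oo)%E.
  rewrite (@le_lt_trans _ _ `|f i|%:E%E) ?ltry// -h_norm (bigD1 j)//=.
  by rewrite leeDl// sume_ge0// => *; exact: Lnorm_ge0.
have [Psi PhiK PsiK] := Phi_bij.
have /choice[gam gamP] : forall ij : 'I_n * 'I_n, exists g : dual_space X,
    ae_eq mu setT (Phi g) (h ij.1 ij.2).
  move=> [i j]; have [G Gh] := LspaceType1_lift (mh i j) (h_fin i j).
  by exists (Psi G); rewrite PsiK.
pose g i j := gam (i, j).
have gP i j : ae_eq mu setT (Phi (g i j)) (h i j) := gamP (i, j).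
have g_norm i j : `|g i j|%:E = 'N[mu]_1[EFin \o h i j]%E.
  by rewrite -Phi_norm; exact: Lnorm1_ae_eq.
exists g; split=> [i j|i|i].
- apply: Phi_inj; have := Phi_linear (-1) (g i j) 0.
  rewrite addr0 scaleN1r; move: (gP j i) (gP i j) => gji gij gN.
  near=> t => _.
  rewrite (near gN t _)// (near Phi0 t _)// (near gji t _)// (near gij t _)//.
  by rewrite mulN1r addr0 /h transportC.
- apply: Phi_inj.
  have all_g : \forall t \ae mu, forall j, Phi (g i j) t = h i j t.
    by apply: filter_forall => j; apply: filterS (gP i j) => t /(_ I).
  have gS := Phi_sum (g i).
  near=> t => _; rewrite (near gS t _)//.
  rewrite -[RHS](@sum_transport _ _ (fun k => Phi (f k) t) i); last first.
    by rewrite (near Sf0 t _).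
  by apply: eq_bigr => j _; rewrite (near all_g t _).
- apply: EFin_inj; rewrite -sumEFin -h_norm.
  by apply: eq_bigr => j _; rewrite g_norm.
Unshelve. all: by end_near. Qed.

End L1Predual.

(** * Almost intersecting balls *)

Section Dual.
Variables (R : realType) (X : normedModType R).
Implicit Types (f g : dual_space X) (x y : X).

Lemma dual_funD f x y : f (x + y) = f x + f y.
Proof. by have := dual_linear f 1 x y; rewrite !scale1r. Qed.

Lemma dual_funN f x : f (- x) = - f x.
Proof. by rewrite -scaleN1r dual_funZ mulN1r. Qed.

Lemma dual_sumE I (r : seq I) (P : pred I) (f : I -> dual_space X) x :
  (\sum_(i <- r | P i) f i : dual_space X) x = \sum_(i <- r | P i) f i x.
Proof. by apply: (big_morph (fun f => f x : R)). Qed.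

Lemma bounded_linear_dual (l : X -> R^o) (M : R) : linear l ->
  (forall x, `|l x| <= M * `|x|) -> exists f, forall x, f x = l x.
Proof.
move=> ll lM; pose L : {linear X -> R^o} :=
  HB.pack l (GRing.isLinear.Build _ _ _ _ _ ll).
have lc : continuous l.
  apply/(linear_bounded_continuous L)/bounded_funP => r.
  exists (`|M| * r) => x xr.
  rewrite (le_trans (lM x))// (le_trans (ler_wpM2r _ (ler_norm M)))//.
  by rewrite ler_wpM2l.
have lP : l \in @dual_pred R X by rewrite inE.
by exists (Dual lP).
Qed.

Lemma dual_norming f e : 0 < e -> exists2 x, `|x| <= 1 & `|f| - e <= f x.
Proof.
move=> e0; have [_ [x /= x1 <-] fx] := sup_adherent e0 (dual_norm_has_sup f).
have [fx0|fx0] := lerP 0 (f x).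
  by exists x => //; rewrite ltW// (lt_le_trans fx)// ger0_norm.
exists (- x); first by rewrite normrN.
by rewrite dual_funN ltW// (lt_le_trans fx)// ltr0_norm.
Qed.

End Dual.

Section BallIntersection.
Variables (R : realType) (X : completeNormedModType R).
Hypothesis X_predual : L1_predual X.

Lemma predual_pairing_le n (f : 'I_n -> dual_space X)
    (x : 'I_n -> X) (r : 'I_n -> R) :
  \sum_i f i = 0 -> (forall i j, `|x i - x j| <= r i + r j) ->
  \sum_i f i (x i) <= \sum_i r i * `|f i|.
Proof.
move=> f0 xr; have [d [T [mu [Phi [Pbij Plin Pnorm]]]]] := X_predual.
have [g [gN gf gnorm]] := dual_transport Pbij Plin Pnorm f0.
have fx : \sum_i f i (x i) = \sum_i \sum_j g i j (x i).
  by apply: eq_bigr => i _; rewrite -[in LHS]gf dual_sumE.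
have fx' : \sum_i f i (x i) = - \sum_i \sum_j g i j (x j).
  rewrite fx exchange_big/= -sumrN; apply: eq_bigr => i _; rewrite -sumrN.
  by apply: eq_bigr => j _; rewrite gN.
have rf : \sum_i r i * `|f i| = \sum_i \sum_j r i * `|g i j|.
  by apply: eq_bigr => i _; rewrite -gnorm mulr_sumr.
have rf' : \sum_i r i * `|f i| = \sum_i \sum_j r j * `|g i j|.
  rewrite rf exchange_big/=; apply: eq_bigr => i _.
  by apply: eq_bigr => j _; rewrite gN normrN.
(* Each side has two expressions, differing by an exchange of indices. Once they are added, the
   terms compare: [g i j (x i - x j) <= |g i j| * (r i + r j)]. *)
suff : \sum_i f i (x i) + \sum_i f i (x i) <=
    \sum_i r i * `|f i| + \sum_i r i * `|f i| by lra.
rewrite {1}fx fx' {1}rf rf' -sumrB -big_split/=.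
apply: ler_sum => i _; rewrite -sumrB -big_split/=; apply: ler_sum => j _.
rewrite -dual_funN -dual_funD -mulrDl (le_trans (ler_norm _))//.
rewrite (le_trans (dual_norm_bound _ _))// mulrC.
by apply: ler_wpM2r => //; exact: (normr_ge0 (g i j)).
Qed.

(* The Minkowski gauge, on [X ^ n], of the sum of the diagonal and of the
   product of the balls of radii [r i]. *)
Definition diag_gauge n (r : 'I_n -> R) (y : 'I_n -> X) : R :=
  inf [set s | 0 <= s /\ exists x, forall i, `|y i - x| <= s * r i].

Section DiagGauge.
Variables (n : nat) (r : 'I_n -> R).
Hypothesis r_gt0 : forall i, 0 < r i.
Implicit Type y : 'I_n -> X.

Let gauge_set y :=
  [set s | 0 <= s /\ exists x, forall i, `|y i - x| <= s * r i].

Let gauge_has_inf y : has_inf (gauge_set y).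
Proof.
split; last by exists 0 => s [].
exists (\sum_i `|y i| / r i); split.
  by apply: sumr_ge0 => i _; rewrite divr_ge0// ltW.
exists 0 => i; rewrite subr0 -ler_pdivrMr// (bigD1 i)//= lerDl.
rewrite sumr_ge0// => j _.
by rewrite divr_ge0// ltW.
Qed.

Lemma diag_gauge_le y s x : 0 <= s -> (forall i, `|y i - x| <= s * r i) ->
  diag_gauge r y <= s.
Proof.
move=> s0 ys; apply: ge_inf; first by case: (gauge_has_inf y).
by split=> //; exists x.
Qed.

(** The admissible [s] form an upward closed set, since the radii are positive. *)
Lemma diag_gauge_lt y s : diag_gauge r y < s ->
  exists x, forall i, `|y i - x| <= s * r i.
Proof.
move=> ys; have s0 : 0 < s - diag_gauge r y by rewrite subr_gt0.
have [u [u0 [x yx]] us] := inf_adherent s0 (gauge_has_inf y).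
exists x => i; rewrite (le_trans (yx i))// ler_wpM2r// ltW//.
by rewrite (lt_le_trans us)// /diag_gauge addrC subrK.
Qed.

Lemma sublinear_diag_gauge : sublinear (diag_gauge r).
Proof.
split=> [y z|t y t0].
  rewrite -lerBlDr; apply: lb_le_inf; first by case: (gauge_has_inf y).
  move=> s [s0 [x yx]]; rewrite lerBlDr -lerBlDl.
  apply: lb_le_inf; first by case: (gauge_has_inf z).
  move=> u [u0 [w zw]]; rewrite lerBlDl.
  apply: (@diag_gauge_le _ _ (x + w)); first exact: addr_ge0.
  move=> i; rewrite mulrDl opprD addrACA (le_trans (ler_normD _ _))//.
  by rewrite lerD.
rewrite -ler_pdivrMl//; apply: lb_le_inf; first by case: (gauge_has_inf y).
move=> s [s0 [x yx]]; rewrite ler_pdivrMl//.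
apply: (@diag_gauge_le _ _ (t *: x)); first by rewrite mulr_ge0// ltW.
move=> i; rewrite -scalerBr normrZ gtr0_norm// -mulrA ler_wpM2l// ltW//.
Qed.

(** Let [l] be linear, below the gauge and equal to it at [y], with components [f i]. The gauge
    vanishes on the diagonal, so the [f i] sum to 0; it is at most 1 on the product of the balls, so
    the sum of the [r i * |f i|] is at most 1. The pairing inequality then bounds [l y]. *)
Lemma diag_gauge_le1 y : (forall i j, `|y i - y j| <= r i + r j) ->
  diag_gauge r y <= 1.
Proof.
move=> yr; have [l [ll lp ly]] := hahn_banach_sublinear y sublinear_diag_gauge.
pose single i x : 'I_n -> X := fun j => if j == i then x else 0.
have l_le i x : l (single i x) <= (r i)^-1 * `|x|.
  rewrite (le_trans (lp _))//; apply: (@diag_gauge_le _ _ 0).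
    by rewrite mulr_ge0// invr_ge0 ltW.
  move=> j; rewrite subr0 /single; case: eqP => [->|_].
    by rewrite mulrAC mulVf ?mul1r// gt_eqF.
  by rewrite normr0 !mulr_ge0// ?invr_ge0 ltW.
have single_linear i : linear (l \o single i : X -> R^o).
  move=> k u v /=; rewrite -ll; congr (l _); apply/funext => j.
  rewrite /single/=
    [RHS]/(k *: (if j == i then u else 0) + (if j == i then v else 0)).
  by case: ifP => // _; rewrite scaler0; exact/esym/addr0.
pose L : {linear ('I_n -> X) -> R^o} :=
  HB.pack l (GRing.isLinear.Build _ _ _ _ _ ll).
have lN z : l (- z) = - l z.
  exact: (linearN L).
have /choice[f fl] : forall i, exists f : dual_space X,
    forall x, f x = l (single i x).
  move=> i; apply: (bounded_linear_dual (M := (r i)^-1) (single_linear i)) => x.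
  rewrite ler_norml l_le andbT lerNl -normrN /=.
  rewrite -lN (_ : - single i x = single i (- x)) ?l_le//.
  by apply/funext => j; rewrite /single fctE; case: ifP; rewrite ?oppr0.
have l_sum z : l z = \sum_i f i (z i).
  have zE : z = \sum_i single i (z i).
    apply/funext => j; rewrite fct_sumE (bigD1 j)//= big1 => [|i ij].
      by rewrite /single eqxx addr0.
    by rewrite /single eq_sym (negbTE ij).
  rewrite [in LHS]zE -[LHS]/(L _) linear_sum.
  by apply: eq_bigr => i _; rewrite fl.
have f0 : \sum_i f i = 0.
  apply: dualP => x; rewrite dual_sumE.
  have lx0 z : \sum_i f i z <= 0.
    rewrite -(l_sum (fun=> z)) (le_trans (lp _))//.
    by apply: (@diag_gauge_le _ _ z) => // i; rewrite subrr normr0 mul0r.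
  apply/eqP; rewrite eq_le lx0/= -oppr_le0 -sumrN.
  by under eq_bigr do rewrite -dual_funN.
have rf : \sum_i r i * `|f i| <= 1.
  (* Each norm is approached within [e / (1 + \sum_i r i)], for a total error of at most [e]; the 1
     keeps the denominator positive when [n = 0]. *)
  apply/ler_addgt0Pr => e e0.
  have S0 : 0 < 1 + \sum_i r i.
    by rewrite ltr_wpDr// sumr_ge0// => i _; exact: ltW.
  have /choice[z zP] : forall i, exists z,
      `|z| <= 1 /\ `|f i| - e / (1 + \sum_i r i) <= f i z.
    move=> i; have [z z1 fz] := dual_norming (f i) (divr_gt0 e0 S0).
    by exists z.
  have lz : l (fun i => r i *: z i) <= 1.
    rewrite (le_trans (lp _))//; apply: (@diag_gauge_le _ _ 0) => // i.
    by rewrite subr0 normrZ gtr0_norm// mul1r ler_piMr ?(zP i).1// ltW.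
  rewrite -lerBlDr (le_trans _ lz)// l_sum.
  apply: (@le_trans _ _ (\sum_i r i * (`|f i| - e / (1 + \sum_i r i)))).
    under [leRHS]eq_bigr do rewrite mulrBr.
    rewrite sumrB lerD2l lerN2 -mulr_suml mulrCA ler_piMr ?ltW//.
    by rewrite ltr_pdivrMr// mul1r ltrDr.
  apply: ler_sum => i _; rewrite dual_funZ ler_wpM2l ?(zP i).2//.
  exact: ltW.
rewrite -ly l_sum (le_trans _ rf)//.
exact: predual_pairing_le f0 yr.
Qed.

End DiagGauge.

Lemma predual_ball_intersection n (x : 'I_n -> X) (r : 'I_n -> R) (e : R) :
  0 < e -> (forall i j, `|x i - x j| <= r i + r j) ->
  exists z, forall i, `|x i - z| <= r i + e.
Proof.
move=> e0 xr.
have r0 i : 0 <= r i by have := xr i i; rewrite subrr normr0; lra.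
(* Half of [e] makes the radii positive; the other half pays for a factor slightly above 1, the
   gauge being an infimum. *)
pose s i := r i + e / 2.
have s0 i : 0 < s i by rewrite ltr_wpDl// divr_gt0.
have xs i j : `|x i - x j| <= s i + s j.
  by rewrite (le_trans (xr i j))// lerD// lerDl divr_ge0// ltW.
have S0 : 0 < 1 + \sum_i s i.
  by rewrite ltr_wpDr// sumr_ge0// => i _; exact: ltW.
have [z xz] : exists z, forall i,
    `|x i - z| <= (1 + e / 2 / (1 + \sum_i s i)) * s i.
  apply: diag_gauge_lt => //; rewrite (le_lt_trans (diag_gauge_le1 s0 xs))//.
  by rewrite ltrDl divr_gt0// divr_gt0.
exists z => i; rewrite (le_trans (xz i))// mulrDl mul1r [in leRHS](splitr e).
rewrite addrA lerD2l -mulrA ler_piMr ?divr_ge0 ?ltW// mulrC ltr_pdivrMr// mul1r.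
rewrite (bigD1 i)//= addrCA ltr_pwDr// ltr_pwDl// sumr_ge0// => j _.
exact: ltW.
Qed.

End BallIntersection.

(** * Density of the evaluations *)

Section Extension.
Variables (R : realType) (Y : normedModType R).

(* One step of the Hahn-Banach extension: [A - c xi] extends the restriction of
   [A] to the kernel of [xi] in [E]. *)
Lemma extend_one_step (E : set Y) (A xi : Y -> R) (e : R) :
  0 <= e -> (forall k f g, E f -> E g -> E (k *: f + g)) -> E 0 ->
  (forall k f g, A (k *: f + g) = k * A f + A g) ->
  (forall k f g, xi (k *: f + g) = k * xi f + xi g) ->
  (forall f, E f -> xi f = 0 -> `|A f| <= e * `|f|) ->
  exists c, forall f, E f -> `|A f - c * xi f| <= e * `|f|.
Proof.
move=> e0 E_lin E0 A_lin xi_lin AE.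
have A0 : A 0 = 0.
  by have := A_lin (-1) 0 0; rewrite scaler0 addr0 mulN1r addNr.
have xi0 : xi 0 = 0.
  by have := xi_lin (-1) 0 0; rewrite scaler0 addr0 mulN1r addNr.
have sub_le g h : E g -> E h -> xi g = 1 -> xi h = 1 ->
    A g - e * `|g| <= A h + e * `|h|.
  move=> Eg Eh xig xih.
  have : `|A (-1 *: h + g)| <= e * `|-1 *: h + g|.
    by apply: AE; [exact: E_lin|rewrite xi_lin xig xih; ring].
  rewrite A_lin => /(le_trans (ler_norm _)) Agh.
  have := ler_wpM2l e0 (ler_normD (-1 *: h) g).
  rewrite scaleN1r normrN in Agh *; lra.
(* By [sub_le], [sup S] separates the lower bounds on [c] from the upper ones; an [f] with
   [xi f != 0] is rescaled to [xi = 1]. If [xi] vanishes on [E], [S] is empty and any [c] works. *)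
pose S := [set A g - e * `|g| | g in [set g | E g /\ xi g = 1]].
exists (sup S) => f Ef; have [xif|xif] := eqVneq (xi f) 0.
  by rewrite xif mulr0 subr0 AE.
pose g := (xi f)^-1 *: f.
have Zlin (B : Y -> R) k h : B 0 = 0 ->
    (forall k f g, B (k *: f + g) = k * B f + B g) -> B (k *: h) = k * B h.
  by move=> B0 Blin; have := Blin k h 0; rewrite B0 !addr0.
have Eg : E g by rewrite -[g]addr0; exact: E_lin.
have xig : xi g = 1 by rewrite Zlin// mulVf.
have supS : has_sup S.
  split; first by exists (A g - e * `|g|), g.
  by exists (A g + e * `|g|) => _ [h [Eh xih] <-]; exact: sub_le.
have gS : A g - e * `|g| <= sup S.
  by apply: ub_le_sup; [case: supS|exists g].
have Sg : sup S <= A g + e * `|g|.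
  by apply: ge_sup; [case: supS|move=> _ [h [Eh xih] <-]; exact: sub_le].
have fE : f = xi f *: g by rewrite scalerA mulfV// scale1r.
have Af : A f = xi f * A g by rewrite {1}fE Zlin.
have nf : `|f| = `|xi f| * `|g| by rewrite {1}fE normrZ.
rewrite Af nf [sup S * _]mulrC -mulrBr normrM mulrCA.
by rewrite ler_wpM2l// ler_norml; apply/andP; split; lra.
Qed.

End Extension.

Section Density.
Variables (R : realType) (X : normedModType R).
Implicit Types (a : Asigma X) (f g : dual_space X).

(** By induction on [s]: subtracting a multiple of the evaluation at [x] from [A] makes it small on
    the common kernel of the remaining points. *)
Lemma functional_near_eval (s : seq X) (A : dual_space X -> R) (e : R) :
  0 <= e -> (forall k f g, A (k *: f + g) = k * A f + A g) ->
  (forall f, (forall x, x \in s -> f x = 0) -> `|A f| <= e * `|f|) ->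
  exists x, forall f, `|A f - f x| <= e * `|f|.
Proof.
move=> e0; elim: s A => [|x s IH] A A_lin As.
  by exists 0 => f; rewrite dual_fun0 subr0 As.
have eval_lin k (f g : dual_space X) y : (k *: f + g) y = k * f y + g y by [].
have [|||||c Ac] := @extend_one_step _ _
    [set f : dual_space X | forall y, y \in s -> f y = 0]
    A (fun f : dual_space X => f x) e e0.
- move=> k f g fs gs y ys.
  by rewrite eval_lin fs// gs// mulr0 addr0.
- by [].
- exact: A_lin.
- by move=> k f g; exact: eval_lin.
- move=> f fs fx; apply: As => y; rewrite in_cons => /predU1P[->//|]; exact: fs.
have [k f g|f fs|y Ay] := IH (fun f : dual_space X => A f - c * f x).
- by rewrite A_lin eval_lin; ring.
- exact: Ac.
exists (y + c *: x) => f.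
by rewrite dual_funD dual_funZ opprD addrA addrAC.
Qed.

(* In the weak* topology, the filter generated by the sets
   [{f | f x = 0 for x in s}], with [s] finite, converges to 0. *)
Lemma Asigma_small_on_ker a (e : R) : 0 < e -> exists s : seq X,
  forall f : dual_ball X, (forall x, x \in s -> f x = 0) -> `|a f| <= e.
Proof.
move=> e0.
pose K : set_system (dual_ball X) := [set U | exists s : seq X,
  forall f : dual_ball X, (forall x, x \in s -> f x = 0) -> U f].
have KF : Filter K.
  split; first by exists [::].
    move=> P Q [s sP] [t tQ]; exists (s ++ t) => f fst.
    by split; [apply: sP|apply: tQ] => x xs; apply: fst;
      rewrite mem_cat xs ?orbT.
  by move=> P Q PQ [s sP]; exists s => f /sP /PQ.
have K0 : K --> dual_ball0 X.
  apply: cvg_dual_ball => x U /nbhs_singleton U0; exists [:: x] => f /(_ x).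
  by rewrite inE eqxx => /(_ isT) fx; rewrite /= fx.
have a0 : a (dual_ball0 X) = 0.
  have := Asigma_odd a (dual_ball0 X).
  rewrite (_ : dual_ball_opp _ = dual_ball0 X); first by lra.
  by apply: val_inj; rewrite /= oppr0.
have /(_ (dual_ball0 X)) ca := (Asigma_affine_continuous a).2.
have aK : (fun f : dual_ball X => a f : R) @ K --> (a (dual_ball0 X) : R).
  exact: cvg_trans (cvg_app a K0) ca.
move: aK => /(@cvgrPdist_le _ _ _ K)/(_ e e0) [s sK].
by exists s => f /sK; rewrite /= a0 sub0r normrN.
Qed.

Let val_insubd f : `|f| <= 1 ->
  \val (insubd (dual_ball0 X) f) = f.
Proof. by move=> f1; exact: insubdK. Qed.

(* Any positive radius at least [`|f|] gives the same value as [1 + `|f|]. *)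
Definition Asigma_ext a f : R :=
  (1 + `|f|) * a (insubd (dual_ball0 X) ((1 + `|f|)^-1 *: f)).

Section Ext.
Variable a : Asigma X.
Let b f : R := a (insubd (dual_ball0 X) f).

Let bN f : `|f| <= 1 -> b (- f) = - b f.
Proof.
move=> f1; rewrite /b [in RHS]Asigma_odd opprK; congr (a _).
by apply: val_inj; rewrite /= !val_insubd ?normrN.
Qed.

Let b_conv (t : R) f g : 0 <= t -> t <= 1 -> `|f| <= 1 -> `|g| <= 1 ->
  b (t *: f + (1 - t) *: g) = t * b f + (1 - t) * b g.
Proof.
move=> t0 t1 f1 g1; have := (Asigma_affine_continuous a).1 (Itv01 t0 t1)
  (insubd (dual_ball0 X) f) (insubd (dual_ball0 X) g).
rewrite convRE /= => <-; congr (a _); apply: val_inj.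
rewrite val_insubd; last first.
  rewrite (le_trans (ler_normD _ _))// !normrZ (ger0_norm t0).
  rewrite ger0_norm ?subr_ge0//.
  rewrite [leRHS](_ : 1 = t * 1 + (1 - t) * 1); last by ring.
  by rewrite lerD// ler_wpM2l// subr_ge0.
by rewrite -[RHS]/(t *: \val (insubd (dual_ball0 X) f)
  + (1 - t) *: \val (insubd (dual_ball0 X) g)) !val_insubd.
Qed.

Let bZ t f : 0 <= t -> t <= 1 -> `|f| <= 1 -> b (t *: f) = t * b f.
Proof.
move=> t0 t1 f1; have := @b_conv t f 0 t0 t1 f1.
have b0 : b 0 = 0 by have := @bN 0; rewrite normr0 oppr0 => /(_ ler01); lra.
by rewrite normr0 b0 scaler0 !addr0 mulr0 addr0 => ->.
Qed.

(** For [K <= L], [L^-1 *: f] is the multiple of [K^-1 *: f] by [K / L], a factor in [0, 1], for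
    which [a], affine and odd, is homogeneous. *)
Lemma Asigma_extE f (M : R) : 0 < M -> `|f| <= M ->
  Asigma_ext a f = M * b (M^-1 *: f).
Proof.
have le_ (K L : R) : 0 < K -> K <= L -> `|f| <= K ->
    K * b (K^-1 *: f) = L * b (L^-1 *: f).
  move=> K0 KL fK; have L0 : 0 < L by exact: lt_le_trans KL.
  have -> : L^-1 *: f = (K / L) *: (K^-1 *: f).
    by rewrite scalerA mulrAC mulfV ?mul1r// gt_eqF.
  rewrite (@bZ (K / L)) ?divr_ge0 ?(ltW K0) ?(ltW L0)//.
  - by field; rewrite gt_eqF.
  - by rewrite ler_pdivrMr// mul1r.
  - by rewrite normrZ gtr0_norm ?invr_gt0// ler_pdivrMl// mulr1.
move=> M0 fM; rewrite /Asigma_ext.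
have [fM1|fM1] := lerP M (1 + `|f|); first exact/esym/le_.
by apply: le_ => //; rewrite ?ltr_pwDl// ?lerDr// ltW.
Qed.

Lemma Asigma_ext_linear k f g :
  Asigma_ext a (k *: f + g) = k * Asigma_ext a f + Asigma_ext a g.
Proof.
have extN h : Asigma_ext a (- h) = - Asigma_ext a h.
  rewrite /Asigma_ext normrN scalerN -mulrN; congr (_ * _); apply: bN.
  rewrite normrZ gtr0_norm ?invr_gt0 ?ltr_pwDl// ler_pdivrMl ?ltr_pwDl//.
  by rewrite mulr1 lerDr.
have extD h i : Asigma_ext a (h + i) = Asigma_ext a h + Asigma_ext a i.
  (* [M] bounds both norms and [2 * M] that of the sum: [h + i], rescaled, is the midpoint of [h]
     and [i] rescaled by [M]. *)
  pose M := 1 + `|h| + `|i|.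
  have M0 : 0 < M by rewrite /M -addrA ltr_pwDl// addr_ge0.
  have hM : `|h| <= M by rewrite /M addrAC lerDr addr_ge0.
  have iM : `|i| <= M by rewrite /M lerDr addr_ge0.
  rewrite (@Asigma_extE h M)// (@Asigma_extE i M)// (@Asigma_extE _ (2 * M)).
  - have -> : (2 * M)^-1 *: (h + i) =
        2^-1 *: (M^-1 *: h) + (1 - 2^-1) *: (M^-1 *: i).
      rewrite scalerDr !scalerA invfM; congr (_ + _ *: _); congr (_ * _); lra.
    have normM j : `|j| <= M -> `|M^-1 *: j| <= 1.
      by move=> jM; rewrite normrZ gtr0_norm ?invr_gt0// ler_pdivrMl// mulr1.
    have h0 : 0 <= 2^-1 :> R by lra.
    have h1 : 2^-1 <= 1 :> R by lra.
    rewrite (b_conv h0 h1) ?normM//.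
    rewrite (_ : 1 - 2^-1 = 2^-1 :> R); last by lra.
    by rewrite -!mulrDr [2 * M]mulrC -mulrA mulVKf.
  - by rewrite mulr_gt0.
  - by rewrite (le_trans (ler_normD _ _))// mulrDl mul1r lerD.
have extZ t h : 0 < t -> Asigma_ext a (t *: h) = t * Asigma_ext a h.
  move=> t0; have h0 : 0 < 1 + `|h| by rewrite ltr_pwDl.
  rewrite (@Asigma_extE _ (t * (1 + `|h|))) ?mulr_gt0//.
    rewrite -mulrA; congr (_ * (_ * b _)).
    by rewrite scalerA invfM mulrAC mulVf ?gt_eqF// mul1r.
  by rewrite normrZ gtr0_norm// ler_wpM2l ?ltW// ltrDr.
rewrite extD; congr (_ + _); have [k0|k0|->] := ltgtP k 0.
- by rewrite -[k in LHS]opprK scaleNr extN extZ ?oppr_gt0// mulNr opprK.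
- exact: extZ.
- by have := extD 0 0; rewrite scale0r addr0 mul0r; lra.
Qed.

Lemma Asigma_ext_ball (f : dual_ball X) : Asigma_ext a f = a f.
Proof.
rewrite (@Asigma_extE _ 1)//; last by case: f.
by rewrite invr1 scale1r mul1r /b valKd.
Qed.

End Ext.

Lemma Asigma_near_eval a (e : R) : 0 < e ->
  exists x, forall f : dual_ball X, `|a f - f x| <= e.
Proof.
move=> e0; have [s sa] := Asigma_small_on_ker a e0.
have [f fs|x xP] := @functional_near_eval s (Asigma_ext a) e (ltW e0)
  (@Asigma_ext_linear a).
  have [->|f0] := eqVneq f 0.
    have := Asigma_ext_linear a (-1) 0 0.
    by rewrite scaler0 addr0 mulN1r addNr => ->; rewrite !normr0 mulr0.
  (* With the radius [|f|], the rescaled functional is in the ball and still vanishes on [s]. *)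
  rewrite (@Asigma_extE _ _ `|f|) ?normr_gt0// normrM normr_id mulrC.
  rewrite ler_wpM2r//.
  apply: sa => x xs; rewrite val_insubd.
    by rewrite -[LHS]/(`|f|^-1 * f x) fs// mulr0.
  by rewrite normrZ normfV normr_id mulVf// normr_eq0.
exists x => f; rewrite -Asigma_ext_ball (le_trans (xP _))//.
by rewrite ler_piMr ?(ltW e0)//; case: f.
Qed.

End Density.

(** * Centers of compact sets *)

Section CompactCenters.
Variables (R : realType) (Y : completeNormedModType R).
Hypothesis almost_intersecting_balls :
  forall n (y : 'I_n -> Y) (r : 'I_n -> R) (e : R), 0 < e ->
  (forall i j, `|y i - y j| <= r i + r j) ->
  exists z, forall i, `|y i - z| <= r i + e.
Variables (F : set Y) (r : R).
Hypothesis F_compact : compact F.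
Hypothesis F_diam : forall b c, F b -> F c -> `|b - c| <= 2 * r.

Lemma finite_net (e : R) : 0 < e -> exists s : seq Y,
  (forall c, c \in s -> F c) /\
  (forall b, F b -> exists2 c, c \in s & `|b - c| < e).
Proof.
move=> e0; have := F_compact; rewrite compact_cover.
move=> /(_ Y F (fun c => ball c e)) [||D DF FD].
- by move=> c _; exact: ball_open.
- by move=> b Fb; exists b => //; exact: ballxx.
- exists (finmap.enum_fset D); split=> [c /DF/set_mem//|b /FD[c Dc cb]].
  by exists c => //; rewrite -ball_normE/= in cb; rewrite distrC.
Qed.

(** The balls have radius [r] around an [e / 4]-net of [F] and radius [e] around [a]. If [z] meets
    them up to [e / 4], it is within [r + e / 2] of each point of [F], the other [e / 4] being due
    to the net, and within [5 e / 4] of [a]. *)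
Lemma almost_center_refine a (e : R) : 0 < e ->
  (forall b, F b -> `|a - b| <= r + e) -> exists a',
  (forall b, F b -> `|a' - b| <= r + e / 2) /\ `|a' - a| <= 2 * e.
Proof.
move=> e0 aF; have e40 : 0 < e / 4 by rewrite divr_gt0.
have [s [sF Fs]] := finite_net e40.
(* The default value of [nth] makes [a] the center of the last ball. *)
pose y (i : 'I_(size s).+1) := nth a s i.
pose t (i : 'I_(size s).+1) := if (i < size s)%N then r else e.
have yF i : (i < size s)%N -> F (nth a s i).
  by move=> ?; apply: sF; exact: mem_nth.
have [i j|z yz] := almost_intersecting_balls (y := y) (r := t) e40.
  rewrite /y /t; have [si|si] := ltnP i (size s);
    have [sj|sj] := ltnP j (size s).
  - by rewrite (le_trans (F_diam (yF _ si) (yF _ sj)))//; lra.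
  - by rewrite (nth_default _ sj) distrC aF//; exact: yF.
  - by rewrite (nth_default _ si) (addrC e) aF//; exact: yF.
  - by rewrite !nth_default// subrr normr0 addr_ge0 ?ltW.
exists z; split=> [b /Fs[c cs bc]|].
  have ci : (index c s < size s)%N by rewrite index_mem.
  have /= := yz (inord (index c s)).
  rewrite /y /t inordK ?ci ?nth_index//; last exact: ltnW.
  have := ler_distD c z b; rewrite (distrC z c) (distrC c b); lra.
have := yz ord_max; rewrite /y /t /= ltnn nth_default// distrC; lra.
Qed.

Lemma compact_center : exists a, forall b, F b -> `|a - b| <= r.
Proof.
have [->|/set0P[a0 Fa0]] := eqVneq F set0; first by exists 0.
have r0 : 0 <= r by have := F_diam Fa0 Fa0; rewrite subrr normr0; lra.
(* Thanks to [r + 1], [e n] is positive even when [r = 0]; [r <= e 0] makes every point of [F] a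
   valid start. *)
pose e n : R := (r + 1) / 2 ^+ n.
have e_gt0 n : 0 < e n by rewrite divr_gt0 ?exprn_gt0//; lra.
have eS n : e n.+1 = e n / 2 by rewrite /e exprS invfM; ring.
pose ok n a := forall b, F b -> `|a - b| <= r + e n.
have /choice[next nextP] : forall na : nat * Y, exists a',
    ok na.1 na.2 -> ok na.1.+1 a' /\ `|a' - na.2| <= 2 * e na.1.
  move=> [n a]; have [oka|] := pselect (ok n a); last by exists a.
  have [a' [Fa' aa']] := almost_center_refine (e_gt0 n) oka.
  by exists a' => _; split=> // b Fb /=; rewrite eS Fa'.
pose u := fix u n := if n is m.+1 then next (m, u m) else a0.
have u_ok n : ok n (u n).
  elim: n => [|n IH]; last by have [] := nextP (n, u n) IH.
  by move=> b Fb; have := F_diam Fa0 Fb; rewrite /e expr0 divr1 /=; lra.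
have u_step n : `|u n.+1 - u n| <= 2 * e n.
  by have [] := nextP (n, u n) (u_ok n).
have eE : e = geometric (r + 1) 2^-1 by apply/funext => n; rewrite /e /= exprVn.
have half_lt1 : `|2^-1 : R| < 1 by rewrite gtr0_norm; lra.
(* The steps are dominated by a geometric series, so completeness applies. *)
have cvg_u : cvgn (series (telescope u)).
  apply: normed_cvg; apply: (@series_le_cvg _ _ (geometric (2 * (r + 1)) 2^-1)).
  - by move=> n; exact: normr_ge0.
  - by move=> n; apply: geometric_ge0; lra.
  - by move=> n; rewrite /telescope /= (le_trans (u_step n))// eE /= mulrA.
  - exact: is_cvg_geometric_series.
exists (u 0%N + limn (series (telescope u))) => b Fb.
have u_cvg : u @ \oo --> u 0%N + limn (series (telescope u)).
  rewrite [X in X @ _](_ : u = (fun n => u 0%N + series (telescope u) n)).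
    exact: (cvgD (cvg_cst _) cvg_u).
  by apply/funext => n; exact: eq_sum_telescope.
have e_cvg0 : e @ \oo --> (0 : R) by rewrite eE; exact: cvg_geometric.
have e_cvg : (fun n => r + e n) @ \oo --> r.
  have := @cvgD _ R^o _ _ _ (cst r) e r 0 (cvg_cst r) e_cvg0.
  by rewrite addr0; exact.
apply: (@ler_cvg_to _ _ _ _ (fun n => `|u n - b|) (fun n => r + e n)) e_cvg _.
- by apply: cvg_norm; apply: cvgB => //; exact: cvg_cst.
- by apply: nearW => n; exact: u_ok.
Qed.

End CompactCenters.

(** * Evaluations and intersection of balls in [Asigma] *)

Section Evaluation.
Variables (R : realType) (X : normedModType R).

(** The Hahn-Banach theorem for the norm gives a functional of the ball with value [|x|] at [x]. *)
Lemma norm_le_dual_ball (x : X) (M : R) :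
  (forall f : dual_ball X, `|f x| <= M) -> `|x| <= M.
Proof.
move=> fM; have norm_sublin : sublinear (fun x : X => `|x|).
  by split=> [y z|t y t0]; [exact: ler_normD|rewrite normrZ gtr0_norm].
have [l [ll lp lx]] := hahn_banach_sublinear x norm_sublin.
have l0 : l 0 = 0 by have := ll (-1) 0 0; rewrite scaler0 addr0 scaleN1r addNr.
have lN y : l (- y) = - l y by have := ll (-1) y 0; rewrite !scaleN1r l0 !addr0.
have l_le y : `|l y| <= 1 * `|y|.
  by rewrite mul1r ler_norml lp andbT lerNl -lN -(normrN y) lp.
have [g gl] := bounded_linear_dual ll l_le.
have g1 : `|g| <= 1.
  by apply: dual_norm_le => y y1; rewrite gl (le_trans (l_le y))// mul1r.
rewrite -lx -gl (le_trans (ler_norm _))//.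
exact: (fM (DualBall g1)).
Qed.

Lemma Asigma_eval (x : X) : exists a : Asigma X,
  forall f : dual_ball X, a f = f x.
Proof.
pose l (f : dual_ball X) : R^o := f x.
have lP : l \in @Asigma_pred R X.
  rewrite inE; split; [split=> [t f g|]|].
  - by rewrite convRE.
  - exact: dual_ball_eval_continuous.
  - by apply/funext => f; rewrite /l /= opprK.
by exists (MkAsigma lP).
Qed.

End Evaluation.

(** Three errors of [e / 3]: radii enlarged for evaluations close to the [a i], balls of [X] that
    only almost meet, and the return to the [a i]. *)
Lemma Asigma_ball_intersection (R : realType) (X : completeNormedModType R)
    (X_predual : L1_predual X) n (a : 'I_n -> Asigma X) (r : 'I_n -> R)
    (e : R) :
  0 < e -> (forall i j, `|a i - a j| <= r i + r j) ->
  exists c, forall i, `|a i - c| <= r i + e.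
Proof.
move=> e0 ar; have e30 : 0 < e / 3 by rewrite divr_gt0.
have /choice[x ax] := fun i => Asigma_near_eval (a i) e30.
have xr i j : `|x i - x j| <= (r i + e / 3) + (r j + e / 3).
  apply: norm_le_dual_ball => f.
  have aij : `|a i f - a j f| <= r i + r j.
    exact: le_trans (Asigma_norm_ge (a i - a j) f) (ar i j).
  move: (ax i f) (ax j f) aij; rewrite dual_funD dual_funN !ler_norml.
  by move=> /andP[? ?] /andP[? ?] /andP[? ?]; apply/andP; split; lra.
have [z xz] := predual_ball_intersection X_predual e30 xr.
have [c cz] := Asigma_eval z.
exists c => i; apply: Asigma_norm_le => f.
have xzf : `|f (x i) - f z| <= r i + e / 3 + e / 3.
  by rewrite -dual_funN -dual_funD (le_trans (dual_ball_bound _ _)).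
rewrite -[X in `|X|]/(a i f - c f) cz.
move: (ax i f) xzf; rewrite !ler_norml.
by move=> /andP[? ?] /andP[? ?]; apply/andP; split; lra.
Qed.

(** * Envelopes, radii and centers of a compact set *)

Section Centers.
Variables (R : realType) (X : completeNormedModType R) (F : set (Asigma X)).
Hypotheses (F_neq0 : F !=set0) (F_compact : compact F).
Implicit Types (a b : Asigma X) (f : dual_ball X).

Let F_bounded : exists K, forall b, F b -> `|b| <= K.
Proof.
have [K [_ FK]] := compact_bounded F_compact.
by exists (K + 1) => b Fb; apply: (FK (K + 1)) => //; rewrite ltrDl.
Qed.

Let values_bounded f : has_sup [set b f | b in F] /\ has_inf [set b f | b in F].
Proof.
have [K FK] := F_bounded; have [b0 Fb0] := F_neq0.
have bK b : F b -> - K <= b f <= K.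
  by move=> Fb; rewrite -ler_norml (le_trans (Asigma_norm_ge b f))//; exact: FK.
split; split; try by exists (b0 f), b0.
- by exists K => _ [b /bK/andP[_ ?] <-].
- by exists (- K) => _ [b /bK/andP[? _] <-].
Qed.

Lemma M_of_ge b f : F b -> b f <= M_of F f.
Proof.
by move=> Fb; apply: ub_le_sup; [case: (values_bounded f).1|exists b].
Qed.

Lemma M_of_le f c : (forall b, F b -> b f <= c) -> M_of F f <= c.
Proof.
move=> Fc; apply: ge_sup; first by case: (values_bounded f).1.
by move=> _ [b Fb <-]; exact: Fc.
Qed.

Lemma m_of_le b f : F b -> m_of F f <= b f.
Proof.
by move=> Fb; apply: ge_inf; [case: (values_bounded f).2|exists b].
Qed.

Lemma m_of_ge f c : (forall b, F b -> c <= b f) -> c <= m_of F f.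
Proof.
move=> Fc; apply: lb_le_inf; first by case: (values_bounded f).2.
by move=> _ [b Fb <-]; exact: Fc.
Qed.

(** Two values at [f] of members of [F] are both within [s] of [a f]. Hence [r_of F] is at most
    every radius; with [a = 0], the supremum in [r_of F] is finite. *)
Lemma envelope_gap_le a (s : R) f : (forall b, F b -> `|a - b| <= s) ->
  M_of F f - m_of F f <= 2 * s.
Proof.
move=> aF; rewrite lerBlDr; apply: M_of_le => b Fb.
rewrite -lerBlDl; apply: m_of_ge => c Fc.
have := le_trans (Asigma_norm_ge (a - b) f) (aF _ Fb).
have := le_trans (Asigma_norm_ge (a - c) f) (aF _ Fc).
rewrite -[X in `|X| <= _ -> _]/(a f - c f).
rewrite -[X in _ -> `|X| <= _ -> _]/(a f - b f).
by rewrite !ler_norml => /andP[? ?] /andP[? ?]; lra.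
Qed.

Lemma r_of_le a (s : R) : (forall b, F b -> `|a - b| <= s) -> r_of F <= s.
Proof.
move=> aF; rewrite /r_of ler_pdivrMl//; apply: ge_sup.
  by exists (M_of F (dual_ball0 X) - m_of F (dual_ball0 X)), (dual_ball0 X).
by move=> _ [f _ <-]; exact: envelope_gap_le aF.
Qed.

Lemma r_of_ge f : M_of F f - m_of F f <= 2 * r_of F.
Proof.
rewrite /r_of mulVKf//; apply: ub_le_sup; last by exists f.
have [K FK] := F_bounded; exists (2 * K) => _ [g _ <-].
by apply: (@envelope_gap_le 0) => b Fb; rewrite sub0r normrN FK.
Qed.

Lemma diam_le_r_of b c : F b -> F c -> `|b - c| <= 2 * r_of F.
Proof.
move=> Fb Fc; apply: Asigma_norm_le => f; rewrite -[X in `|X|]/(b f - c f).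
have := r_of_ge f; have := M_of_ge f Fb; have := M_of_ge f Fc.
have := m_of_le f Fb; have := m_of_le f Fc.
by rewrite ler_norml => *; apply/andP; split; lra.
Qed.

(** The inequalities [b f - r_of F <= a f <= b f + r_of F] pass to the supremum of the [b f] on the
    left and to their infimum on the right. *)
Lemma band_dist a :
  (forall f, M_of F f - r_of F <= a f /\ a f <= m_of F f + r_of F) <->
  (forall b, F b -> `|a - b| <= r_of F).
Proof.
split=> [aF b Fb|aF f].
  apply: Asigma_norm_le => f; rewrite -[X in `|X|]/(a f - b f).
  have [? ?] := aF f; have := M_of_ge f Fb; have := m_of_le f Fb.
  by rewrite ler_norml => *; apply/andP; split; lra.
have abf b : F b -> - r_of F <= a f - b f <= r_of F.
  move=> Fb; rewrite -ler_norml (le_trans (Asigma_norm_ge (a - b) f))//.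
  exact: aF.
split.
  by rewrite lerBlDr; apply: M_of_le => b /abf /andP[? ?]; lra.
by rewrite -lerBlDr; apply: m_of_ge => b /abf /andP[? ?]; lra.
Qed.

Lemma radius_at_ge a b : F b -> `|a - b| <= radius_at a F.
Proof.
move=> Fb; apply: ub_le_sup; last by exists b.
have [K FK] := F_bounded; exists (`|a| + K) => _ [c Fc <-].
by rewrite (le_trans (ler_normB _ _))// lerD2l FK.
Qed.

Lemma radius_at_le a (s : R) : (forall b, F b -> `|a - b| <= s) ->
  radius_at a F <= s.
Proof.
move=> aF; have [b0 Fb0] := F_neq0.
apply: ge_sup; first by exists `|a - b0|, b0.
by move=> _ [b Fb <-]; exact: aF.
Qed.

Lemma r_of_le_radius_at a : r_of F <= radius_at a F.
Proof. by apply: (@r_of_le a) => b; exact: radius_at_ge. Qed.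

End Centers.

Theorem theorem3p6 (R : realType) (X : completeNormedModType R)
    (X_predual : L1_predual X) (F : set (Asigma X))
    (F_neq0 : F !=set0) (F_compact : compact F) :
  [/\ cheb_cent F !=set0,
      cheb_cent F = [set a : Asigma X | forall f : dual_ball X,
                  M_of F f - r_of F <= a f /\ a f <= m_of F f + r_of F] &
      cheb_rad F = r_of F].
Proof.
(* [a0], common to the balls of radius [r_of F], attains the lower bound [r_of F] of all radii. *)
have [a0 a0F] := compact_center (Asigma_ball_intersection X_predual) F_compact
  (diam_le_r_of F_neq0 F_compact).
have radE : cheb_rad F = r_of F.
  apply/eqP; rewrite eq_le; apply/andP; split.
    rewrite (le_trans _ (radius_at_le F_neq0 a0F))//.
    apply: ge_inf; last by exists a0.
    by exists (r_of F) => _ [a _ <-]; exact: r_of_le_radius_at.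
  apply: lb_le_inf; first by exists (radius_at a0 F), a0.
  by move=> _ [a _ <-]; exact: r_of_le_radius_at.
(* No radius is below [r_of F], so being a center amounts to lying in all these balls. *)
have centE : cheb_cent F =
    [set a : Asigma X | forall b, F b -> `|a - b| <= r_of F].
  apply/seteqP; split=> a /=; rewrite /cheb_cent /= radE => aF.
    by move=> b /(radius_at_ge F_compact a); rewrite aF.
  by apply/eqP; rewrite eq_le radius_at_le//= r_of_le_radius_at.
split=> //; first by exists a0; rewrite centE.
by rewrite centE; apply/seteqP; split=> a /(band_dist F_neq0 F_compact a).
Qed.
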